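(* Let $\gamma:I\to\mathbb{M}^3(C)$ be an arclength parametrized nonplanar curve. Then $\gamma$ is a proper concircular helix with constant rectifying slope if and only if its curvature and torsion are given by $\kappa_\gamma=m\mu$ and $\tau_\gamma=\rho\kappa_\gamma$, where $m$ and $\rho$ are nonzero constants and the differentiable function $\mu$ on $I$ satisfies $$\mu''+C\frac{\rho^2}{1+\rho^2}\,\mu=0.$$
   Context: Let $C\neq0$ be real, $C=\varepsilon/R^2$, $R>0$, $\varepsilon=(-1)^\nu$, $\nu\in\{0,1\}$. $\mathbb{R}^{4}_\nu$ is $\mathbb{R}^{4}$ with the flat metric $\langle\,,\rangle=\varepsilon\,dx_1^2+dx_2^2+dx_3^2+dx_4^2$, and $\mathbb{M}^3(C)=\{p\in\mathbb{R}^4_\nu:\langle p,p\rangle=1/C\}$ (the sheet $x_1>0$ if $C<0$) with the induced metric, of constant curvature $C$ and Levi-Civita connection $\overline\nabla$. A vector field $V$ on $\mathbb{M}^3(C)$ is concircular if $\overline\nabla_XV=\mu X$ for all tangent $X$, for some smooth function $\mu$ (the concircular factor). $I$ is an open interval; curves are smooth, with curvature $\kappa_\gamma>0$ and Frenet frame $\{T_\gamma,N_\gamma,B_\gamma\}$ in $\mathbb{M}^3(C)$: $\overline\nabla_{T_\gamma}T_\gamma=\kappa_\gamma N_\gamma$, $\overline\nabla_{T_\gamma}N_\gamma=-\kappa_\gamma T_\gamma+\tau_\gamma B_\gamma$, $\overline\nabla_{T_\gamma}B_\gamma=-\tau_\gamma N_\gamma$. $\gamma$ is planar if $\tau_\gamma\equiv0$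 and nonplanar otherwise. $\gamma$ is a concircular helix with axis $V$ if $V$ is a concircular vector field on $\mathbb{M}^3(C)$ such that $\lambda:=\langle N_\gamma,V\rangle$ is constant along $\gamma$; it is proper if it is nonplanar and $\lambda\neq0$. For a proper concircular helix with axis $V$, write $V(\gamma(s))=t(s)T_\gamma(s)+\lambda N_\gamma(s)+z(s)B_\gamma(s)$; the quotient $t/z$ (where $z\ne0$) is called the rectifying slope of $\gamma$. *)

(* Defs.v *)
From mathcomp Require Import all_boot all_order all_algebra.
From mathcomp Require Import all_classical all_reals all_analysis.

Set Implicit Arguments.
Unset Strict Implicit.
Unset Printing Implicit Defensive.
Import Order.TTheory GRing.Theory Num.Theory.
Import numFieldNormedType.Exports.

Local Open Scope classical_set_scope.
Local Open Scope ring_scope.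

Section Smoothness.
Context {R : realType}.

Definition iterated_derive {E F : normedModType R} (f : E -> F) (vs : seq E) :
    E -> F :=
  foldr (fun v g => 'D_v g) f vs.

(* C^oo on U, for U open and E finite-dimensional: every iterated directional
   derivative (including f itself) is Frechet differentiable at each point. *)
Definition smooth_on {E F : normedModType R} (U : set E) (f : E -> F) : Prop :=
  forall (vs : seq E) (x : E), U x -> differentiable (iterated_derive f vs) x.

(* g is a smooth extension, to a neighborhood of p, of the restriction of f
   to S. *)
Definition local_extension {E F : normedModType R} (S : set E) (f : E -> F)
    (p : E) (g : E -> F) : Prop :=
  exists U : set E,
    [/\ open U, U p, smooth_on U g & forall q, U q -> S q -> g q = f q].

(* Smoothness of f|S for an embedded submanifold S; values of f off S are
   irrelevant. *)
Definition smooth_on_submanifold {E F : normedModType R} (S : set E)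
    (f : E -> F) : Prop :=
  forall p, S p -> exists g, local_extension S f p g.

Definition smooth_on_interval {F : normedModType R} (I : set R) (f : R -> F) :
    Prop :=
  forall (k : nat) (s : R), I s -> derivable (derive1n k f) s 1.

End Smoothness.

Section SpaceForm.
Context {R : realType}.
Implicit Types (nu : bool) (C : R) (p q X : 'rV[R]_4) (V : 'rV[R]_4 -> 'rV[R]_4).

Definition metric nu p q : R :=
  (-1) ^+ nu * p 0 0 * q 0 0 + \sum_(i < 4 | i != 0) p 0 i * q 0 i.

Definition space_form nu C : set 'rV[R]_4 :=
  [set p | metric nu p p = C^-1 /\ (C < 0 -> 0 < p 0 0)].

(* T_p M = p^perp, since M is a level set of p |-> <p, p>. *)
Definition tangent_at nu p X : Prop := metric nu p X = 0.

(* Orthogonal projection on T_p M for p in M, where <p, p> = 1 / C. *)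
Definition tangent_proj nu C p X : 'rV[R]_4 := X - (C * metric nu X p) *: p.

(* Levi-Civita connection of the induced metric: the tangential part of the
   flat derivative, [is_covariant_derivative nu C V p X Y] meaning that
   (nabla_X V)(p) = Y. As X is tangent to M, 'D_X g p does not depend on the
   extension g of V|M. *)
Definition is_covariant_derivative nu C V p X Y : Prop :=
  exists2 g, local_extension (space_form nu C) V p g
           & Y = tangent_proj nu C p ('D_X g p).

Definition concircular nu C V : Prop :=
  [/\ smooth_on_submanifold (space_form nu C) V,
      forall p, space_form nu C p -> tangent_at nu p (V p)
    & exists2 mu : 'rV[R]_4 -> R,
        smooth_on_submanifold (space_form nu C) mu
      & forall p X, space_form nu C p -> tangent_at nu p X ->
          is_covariant_derivative nu C V p X (mu p *: X)].

Implicit Types (I : set R) (kappa tau : R -> R)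
  (gamma T N B W : R -> 'rV[R]_4).

(* Covariant derivative along gamma of a vector field W along gamma. *)
Definition covariant_along nu C gamma W (s : R) : 'rV[R]_4 :=
  tangent_proj nu C (gamma s) (derive1 W s).

Definition smooth_curve nu C I gamma : Prop :=
  smooth_on_interval I gamma /\ forall s, I s -> space_form nu C (gamma s).

Definition arclength nu I gamma : Prop :=
  forall s, I s -> metric nu (derive1 gamma s) (derive1 gamma s) = 1.

(* Both orientations of B (hence both signs of tau) are allowed. *)
Record frenet_apparatus nu C I gamma kappa tau T N B : Prop := {
  frenet_T : forall s, I s -> T s = derive1 gamma s;
  frenet_smoothN : smooth_on_interval I N;
  frenet_smoothB : smooth_on_interval I B;
  frenet_tangent : forall s, I s ->
    [/\ tangent_at nu (gamma s) (T s), tangent_at nu (gamma s) (N s)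
      & tangent_at nu (gamma s) (B s)];
  frenet_unit : forall s, I s ->
    [/\ metric nu (T s) (T s) = 1, metric nu (N s) (N s) = 1
      & metric nu (B s) (B s) = 1];
  frenet_orthogonal : forall s, I s ->
    [/\ metric nu (T s) (N s) = 0, metric nu (T s) (B s) = 0
      & metric nu (N s) (B s) = 0];
  frenet_kappa_gt0 : forall s, I s -> 0 < kappa s;
  frenet_eqT : forall s, I s ->
    covariant_along nu C gamma T s = kappa s *: N s;
  frenet_eqN : forall s, I s ->
    covariant_along nu C gamma N s = - kappa s *: T s + tau s *: B s;
  frenet_eqB : forall s, I s ->
    covariant_along nu C gamma B s = - tau s *: N s
}.

Definition planar I tau : Prop := forall s, I s -> tau s = 0.

Definition concircular_helix nu C I gamma N V (lambda : R) : Prop :=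
  concircular nu C V /\
  forall s, I s -> metric nu (N s) (V (gamma s)) = lambda.

Definition proper_concircular_helix nu C I gamma tau N V (lambda : R) : Prop :=
  [/\ concircular_helix nu C I gamma N V lambda, ~ planar I tau
    & lambda != 0].

(* The rectifying slope t / z is only defined at the parameters where z does
   not vanish. *)
Definition constant_rectifying_slope I gamma T N B V (lambda : R) : Prop :=
  exists t z : R -> R,
    (forall s, I s ->
       V (gamma s) = t s *: T s + lambda *: N s + z s *: B s) /\
    exists c : R, forall s, I s -> z s != 0 -> t s / z s = c.

End SpaceForm.

(* Main.v *)
(* A concircular field V of M is the tangential part v - C <v, q> q of a constant
   vector v.  Indeed D_X V = mu X - C <V, X> q for X tangent, so <n, V> is constant
   on each totally geodesic surface M /\ n^perp; comparing V at two points q, q' along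
   all n orthogonal to both gives V(q) - V(q') in span(q, q'), and working from the
   base point p0 = (r, 0, 0, 0) these relations add up to a single v.

   Along gamma put a = <v, gamma>, t = <v, T>, z = <v, B>.  The Frenet equations give
   a' = t, t' = kappa lambda - C a, kappa t = tau z and z' = - tau lambda.  If t = rho z
   then tau = rho kappa, and comparing t' with rho z' gives
   kappa lambda (1 + rho^2) = C a, so a solves the ODE and is the required mu up to a
   constant factor.  Conversely, lambda = 1 and these formulas define t, z and a from
   kappa, and v = t T + N + z B + C a gamma has zero derivative. *)

Require Import Defs.
From mathcomp Require Import all_boot all_order all_algebra.
From mathcomp Require Import all_classical all_reals all_analysis.
From mathcomp Require Import ring lra.
Import Order.TTheory GRing.Theory Num.Theory.
Import numFieldNormedType.Exports.
Local Open Scope classical_set_scope.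
Local Open Scope ring_scope.

Set Implicit Arguments.
Unset Strict Implicit.
Unset Printing Implicit Defensive.

(** * Differential calculus of vector-valued maps and of functions on intervals *)

Section MatrixCalculus.
Context {R : realFieldType} {E : normedModType R} {m n : nat}.
Implicit Types (k : E -> R) (f : E -> 'M[R]_(m, n)) (x v : E).

Lemma is_derive_mxP f x v df :
  is_derive x v f df <-> forall i j, is_derive x v (fun y => f y i j) (df i j).
Proof.
split=> [[dfx <-] i j|dfx].
  rewrite derive_mx// mxE; apply: DeriveDef => //.
  exact: (derivable_mxP f x v).1.
have df1 : derivable f x v.
  by apply/derivable_mxP => i j; have := dfx i j.
apply: DeriveDef => //; rewrite derive_mx//.
by apply/matrixP => i j; rewrite mxE; apply: derive_val.
Qed.

Lemma is_derive_scalemx k f x v dk df :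
  is_derive x v k dk -> is_derive x v f df ->
  is_derive x v (fun y => k y *: f y) (dk *: f x + k x *: df).
Proof.
move=> hk /is_derive_mxP hf; apply/is_derive_mxP => i j.
have -> : (fun y => (k y *: f y) i j) = k * (fun y => f y i j).
  by apply/funext => y; rewrite mxE.
have hfij := hf i j.
apply: is_derive_eq; rewrite !mxE /GRing.scale/=; ring.
Qed.

End MatrixCalculus.

Lemma differentiable_row {R : realFieldType} {E : normedModType R} {n : nat}
    (f : E -> 'rV[R]_n) (x : E) :
  (forall i, differentiable (fun y => f y 0 i) x) -> differentiable f x.
Proof.
move=> df.
have -> : f = \sum_(i < n) (fun y => f y 0 i *: delta_mx 0 i).
  by apply/funext => y; rewrite fct_sumE [LHS]row_sum_delta.
by apply: differentiable_sum => i; exact: differentiableZl.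
Qed.

(** Turns the directional derivative in [is_covariant_derivative] into a derivative along a curve,
    by the chain rule. *)
Lemma is_derive_diff {R : numFieldType} {E F : normedModType R}
    (g : E -> F) (c : R -> E) (u : R) (dc : E) :
  differentiable g (c u) -> is_derive u 1 c dc ->
  is_derive u 1 (g \o c) ('D_dc g (c u)).
Proof.
move=> dg [hc <-].
have dcu : differentiable c u by apply/derivable1_diffP.
have dgc : differentiable (g \o c) u by apply: differentiable_comp.
apply: DeriveDef; first exact/derivable1_diffP.
by rewrite !deriveE// diff_comp.
Qed.

Lemma is_derive_unique {R : numFieldType} {E F : normedModType R}
    (f : E -> F) (x h : E) (a b : F) :
  is_derive x h f a -> is_derive x h f b -> a = b.
Proof. by move=> [_ <-] [_ <-]. Qed.

Lemma near_derive1 {R : realFieldType} {F : normedModType R} (f g : R -> F)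
    (s : R) (df : F) :
  (\forall u \near s, f u = g u) -> is_derive s 1 f df -> derive1 g s = df.
Proof.
by move=> fg hf; rewrite derive1E; have [_ ->] := near_eq_is_derive fg hf.
Qed.

Lemma is_derive0_interval {R : realType} (I : set R) (f : R -> R) :
  is_interval I -> (forall s, I s -> is_derive s 1 f 0) ->
  forall s t, I s -> I t -> f s = f t.
Proof.
move=> itvI df s t.
wlog st : s t / s <= t => [H|] Is It.
  by case: (leP s t) => [/H|/ltW /H] => [|->//]; exact.
have sub x : x \in `[s, t] -> I x.
  by rewrite in_itv/= => /andP[sx xt]; apply: (itvI s t) => //; rewrite sx.
have [||c _] := @MVT_segment R f (fun=> 0) s t st.
- by move=> x xst; apply/df/sub; exact: subset_itv_oo_cc.
- apply: derivable_within_continuous => x xst.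
  by have := df x (sub _ xst).
- by rewrite mul0r => /eqP; rewrite subr_eq0 => /eqP.
Qed.

(** * Coordinates on R^4 and calculus of the flat metric *)

Lemma ord4_ind (P : 'I_4 -> Prop) : P 0 -> P 1 -> P 2 -> P 3 -> forall i, P i.
Proof.
move=> P0 P1 P2 P3 [[|[|[|[|i]]]] Hi]//.
- by have -> : Ordinal Hi = 0 by exact/val_inj.
- by have -> : Ordinal Hi = 1 by exact/val_inj.
- by have -> : Ordinal Hi = 2 by exact/val_inj.
- by have -> : Ordinal Hi = 3 by exact/val_inj.
Qed.

Definition vec4 {R : realType} (a b c d : R) : 'rV[R]_4 :=
  \row_i nth 0 [:: a; b; c; d] i.

Lemma vec4E {R : realType} (a b c d : R) :
  (vec4 a b c d 0 0 = a) * (vec4 a b c d 0 1 = b) *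
  (vec4 a b c d 0 2 = c) * (vec4 a b c d 0 3 = d).
Proof. by rewrite !mxE. Qed.

Section Metric.
Context {R : realType}.
Implicit Types (nu : bool) (p q v w : 'rV[R]_4).

Lemma metricE nu p q : metric nu p q = (-1) ^+ nu * (p 0 0 * q 0 0) +
  p 0 1 * q 0 1 + p 0 2 * q 0 2 + p 0 3 * q 0 3.
Proof.
rewrite /metric (bigD1 1)//= (bigD1 2)//= (bigD1 3)//= big1 ?addr0; last first.
  by move=> i; move: i; apply: ord4_ind; rewrite ?eqxx// ?andbF.
by rewrite mulrA !addrA.
Qed.

Lemma metricC nu p q : metric nu p q = metric nu q p.
Proof. rewrite !metricE; ring. Qed.

Lemma metricDl nu p q w : metric nu (p + q) w = metric nu p w + metric nu q w.
Proof. rewrite !metricE !mxE; ring. Qed.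

Lemma metricDr nu p q w : metric nu w (p + q) = metric nu w p + metric nu w q.
Proof. rewrite !metricE !mxE; ring. Qed.

Lemma metricZl nu a p q : metric nu (a *: p) q = a * metric nu p q.
Proof. rewrite !metricE !mxE; ring. Qed.

Lemma metricZr nu a p q : metric nu p (a *: q) = a * metric nu p q.
Proof. rewrite !metricE !mxE; ring. Qed.

Lemma metricBl nu p q w : metric nu (p - q) w = metric nu p w - metric nu q w.
Proof. rewrite !metricE !mxE; ring. Qed.

Definition metric_lin := (metricDl, metricDr, metricBl, metricZl, metricZr).

Lemma is_derive_metric {E : normedModType R} nu (f g : E -> 'rV[R]_4)
    (x h : E) (df dg : 'rV[R]_4) :
  is_derive x h f df -> is_derive x h g dg ->
  is_derive x h (fun y => metric nu (f y) (g y))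
    (metric nu df (g x) + metric nu (f x) dg).
Proof.
move=> /is_derive_mxP hf /is_derive_mxP hg.
have -> : (fun y => metric nu (f y) (g y)) =
    (-1) ^+ nu *: ((fun y => f y 0 0) * (fun y => g y 0 0)) +
    (fun y => f y 0 1) * (fun y => g y 0 1) +
    (fun y => f y 0 2) * (fun y => g y 0 2) +
    (fun y => f y 0 3) * (fun y => g y 0 3).
  by apply/funext => y; rewrite metricE.
have hf0 i := hf 0 i; have hg0 i := hg 0 i.
apply: is_derive_eq; rewrite !metricE /GRing.scale/=; ring.
Qed.

Lemma metric0l nu p : metric nu 0 p = 0.
Proof. by rewrite metricE !mxE; ring. Qed.

Lemma is_derive_metric_cst {E : normedModType R} nu (f : E -> 'rV[R]_4)
    (x h : E) (p df : 'rV[R]_4) :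
  is_derive x h f df ->
  is_derive x h (fun y => metric nu p (f y)) (metric nu p df).
Proof.
move=> hf; have h0 := is_derive_metric nu (is_derive_cst p x h) hf.
by apply: (is_derive_eq h0); rewrite metric0l add0r.
Qed.

Lemma differentiable_metric {E : normedModType R} nu v (f : E -> 'rV[R]_4) x :
  (forall i, differentiable (fun y => f y 0 i) x) ->
  differentiable (fun y => metric nu v (f y)) x.
Proof.
move=> df.
have -> : (fun y => metric nu v (f y)) =
    (-1) ^+ nu * v 0 0 *: (fun y => f y 0 0) +
    v 0 1 *: (fun y => f y 0 1) +
    v 0 2 *: (fun y => f y 0 2) + v 0 3 *: (fun y => f y 0 3).
  by apply/funext => y; rewrite metricE mulrA.
by repeat (apply: differentiableD || apply: differentiableZ).
Qed.

End Metric.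

(** * Concircular fields come from constant vectors *)

Section SpaceForm.
Context {R : realType} (nu : bool) (C r : R).
Context (hr : 0 < r).
Context (hC : C = (-1) ^+ nu / r ^+ 2).
Implicit Types (p q n v X : 'rV[R]_4) (V : 'rV[R]_4 -> 'rV[R]_4).

Local Notation M := (space_form nu C).
Local Notation "<[ p , q ]>" := (metric nu p q).

Lemma curvature_neq0 : C != 0.
Proof. by rewrite hC mulf_neq0 ?signr_eq0 ?invr_neq0 ?expf_neq0 ?gt_eqF. Qed.

Lemma curvatureV : C^-1 = (-1) ^+ nu * r ^+ 2.
Proof. by rewrite hC invfM invrK -exprVn invrN invr1. Qed.

Lemma curvature_lt0 : (C < 0) = nu.
Proof.
rewrite hC ltr_pdivrMr ?exprn_gt0// mul0r.
by case: nu; rewrite ?expr1 ?expr0 ?ltrN10 ?ltr10.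
Qed.

Lemma space_form_normE p : M p -> C * <[p, p]> = 1.
Proof. by case=> -> _; rewrite mulfV// curvature_neq0. Qed.

(** On a sphere, 1 + C<q, q'> is half of C<q + q', q + q'>; on a hyperbolic sheet, C<q, q'> is even
    positive by the reverse Cauchy-Schwarz inequality. The bound makes C<x, x> positive for every
    nonzero combination x of q and q' with nonnegative weights, so that x can be rescaled into M. *)
Lemma space_form_cone q q' : M q -> M q' -> q + q' != 0 ->
  -1 < C * <[q, q']>.
Proof.
have r2 : 0 < r ^+ 2 by rewrite exprn_gt0.
rewrite /space_form /= curvature_lt0 curvatureV hC.
move=> [qq q0] [q'q' q'0] yN0.
rewrite mulrAC ltr_pdivlMr// mulN1r.
case: (nu) qq q0 q'q' q'0 => qq q0 q'q' q'0; rewrite ?expr1 ?expr0 in qq q'q' *.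
  move: qq q'q' (q0 isT) (q'0 isT); rewrite !metricE expr1.
  move: (q 0 0) (q 0 1) (q 0 2) (q 0 3) => a0 a1 a2 a3.
  move: (q' 0 0) (q' 0 1) (q' 0 2) (q' 0 3) => b0 b1 b2 b3.
  move=> qq q'q' a0_gt0 b0_gt0.
  suff : a1 * b1 + a2 * b2 + a3 * b3 < a0 * b0 by nra.
  have ab0 : 0 < a0 * b0 by rewrite mulr_gt0.
  rewrite ltNge; apply/negP => le_ab.
  have : (a0 * b0) ^+ 2 <= (a1 * b1 + a2 * b2 + a3 * b3) ^+ 2.
    by rewrite ler_sqr// nnegrE ?(ltW ab0)// (le_trans (ltW ab0)).
  have -> : (a0 * b0) ^+ 2 = (r ^+ 2 + (a1 ^+ 2 + a2 ^+ 2 + a3 ^+ 2)) *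
      (r ^+ 2 + (b1 ^+ 2 + b2 ^+ 2 + b3 ^+ 2)).
    rewrite exprMn; congr (_ * _); lra.
  (* Lagrange's identity: this sum of squares is |a|^2 |b|^2 - (a . b)^2 for the spatial parts a and
     b. *)
  have : 0 <= (a1 * b2 - a2 * b1) ^+ 2 + (a1 * b3 - a3 * b1) ^+ 2 +
      (a2 * b3 - a3 * b2) ^+ 2 by rewrite !addr_ge0 ?sqr_ge0.
  have : 0 <= r ^+ 2 * (a1 ^+ 2 + a2 ^+ 2 + a3 ^+ 2 +
      (b1 ^+ 2 + b2 ^+ 2 + b3 ^+ 2)).
    by rewrite mulr_ge0 ?(ltW r2)// !addr_ge0 ?sqr_ge0.
  have : 0 < r ^+ 2 * r ^+ 2 by rewrite mulr_gt0.
  by move: (r ^+ 2) => R2; lra.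
suff : 0 < metric false (q + q') (q + q').
  by rewrite !metric_lin [metric _ q' q]metricC ?mul1r in qq q'q' *; lra.
rewrite lt_neqAle; apply/andP; split; last first.
  by rewrite metricE expr0 mul1r -!expr2 !addr_ge0 ?sqr_ge0.
apply: contra yN0; rewrite metricE expr0 mul1r eq_sym -!expr2.
rewrite !paddr_eq0 ?addr_ge0 ?sqr_ge0// !sqrf_eq0.
move=> /andP[/andP[/andP[/eqP y0 /eqP y1] /eqP y2] /eqP y3].
apply/eqP/matrixP => i j; rewrite (ord1 i) [RHS]mxE.
by move: j; apply: ord4_ind.
Qed.

(* The squares keep both weights nonnegative on the whole line, so that no
   boundary case arises when the path is differentiated. *)
Lemma space_form_path q q' : M q -> M q' -> q + q' != 0 ->
  exists c : R -> 'rV[R]_4,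
    [/\ c 0 = q, c 1 = q',
        forall u, derivable c u 1, forall u, M (c u)
      & forall n, <[n, q]> = 0 -> <[n, q']> = 0 -> forall u, <[n, c u]> = 0].
Proof.
move=> Mq Mq' qq'; have k_gt := space_form_cone Mq Mq' qq'.
pose x u : 'rV[R]_4 := (1 - u) ^+ 2 *: q + u ^+ 2 *: q'.
pose Q u := C * <[x u, x u]>.
have QE u : Q u = (1 - u) ^+ 4 + u ^+ 4 +
    2 * (C * <[q, q']>) * (u * (1 - u)) ^+ 2.
  rewrite /Q /x !metric_lin [metric _ q' q]metricC.
  transitivity ((1 - u) ^+ 4 * (C * <[q, q]>) + u ^+ 4 * (C * <[q', q']>) +
    2 * (C * <[q, q']>) * (u * (1 - u)) ^+ 2); first ring.
  by rewrite !space_form_normE// !mulr1.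
(* With k = C<q, q'> > -1, Q(u) = ((1 - u)^2 - u^2)^2 + 2 (1 + k) (u (1 - u))^2. The last term is
   positive except at u = 0 and u = 1, where Q is 1. *)
have Q_gt0 u : 0 < Q u.
  rewrite QE.
  have [->|u0] := eqVneq u 0; first by rewrite mul0r subr0; lra.
  have [->|u1] := eqVneq u 1; first by rewrite subrr mulr0; lra.
  have : 0 < (u * (1 - u)) ^+ 2.
    by rewrite exprn_even_gt0//= mulf_neq0// subr_eq0 eq_sym.
  have : 0 <= ((1 - u) ^+ 2 - u ^+ 2) ^+ 2 by rewrite sqr_ge0.
  have -> : ((1 - u) ^+ 2 - u ^+ 2) ^+ 2 =
    (1 - u) ^+ 4 + u ^+ 4 - 2 * (u * (1 - u)) ^+ 2 by ring.
  move: ((u * (1 - u)) ^+ 2) ((1 - u) ^+ 4 + u ^+ 4) => a b.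
  nra.
have Q0 : Q 0 = 1 by rewrite QE mul0r subr0; lra.
have Q1 : Q 1 = 1 by rewrite QE subrr mulr0; lra.
have sQ u : Num.sqrt (Q u) != 0 by rewrite gt_eqF// sqrtr_gt0.
(* The radial projection of [x] to M. *)
exists (fun u => (Num.sqrt (Q u))^-1 *: x u); split.
- by rewrite Q0 sqrtr1 invr1 scale1r /x subr0 !expr1n expr0n scale1r scale0r addr0.
- by rewrite Q1 sqrtr1 invr1 scale1r /x subrr !expr1n expr0n scale1r scale0r add0r.
- move=> u.
  have dx : derivable x u 1.
    have d1 : is_derive u 1 (fun u : R => (1 - u) ^+ 2) (- 2 * (1 - u)).
      have -> : (fun u : R => (1 - u) ^+ 2) = (cst 1 - id) ^+ 2 by [].
      apply: is_derive_eq.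
      by rewrite -[(cst 1 - id) u]/(1 - u) /GRing.scale/=; ring.
    have d2 : is_derive u 1 (fun u : R => u ^+ 2) (2 * u).
      have -> : (fun u : R => u ^+ 2) = id ^+ 2 by [].
      apply: is_derive_eq.
      by rewrite /GRing.scale/=; ring.
    have hq := is_derive_scalemx d1 (is_derive_cst q u 1).
    have hq' := is_derive_scalemx d2 (is_derive_cst q' u 1).
    by have := is_deriveD hq hq'; case.
  have dQ : derivable Q u 1.
    have [dxx _] := is_derive_metric nu (derivableP dx) (derivableP dx).
    by have := derivableZ (k := C) dxx.
  have dsQ : derivable (Num.sqrt \o Q) u 1.
    by have [] := is_derive1_comp (is_derive1_sqrt (Q_gt0 u)) (derivableP dQ).
  have dV : derivable (fun u => (Num.sqrt (Q u))^-1) u 1.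
    exact: (derivableV (f := Num.sqrt \o Q) (sQ u) dsQ).
  by have [] := is_derive_scalemx (derivableP dV) (derivableP dx).
- move=> u; split.
    have -> : <[(Num.sqrt (Q u))^-1 *: x u, (Num.sqrt (Q u))^-1 *: x u]> =
        C^-1 * ((Num.sqrt (Q u)) ^+ 2)^-1 * Q u.
      rewrite metricZl metricZr /Q; field.
      by rewrite curvature_neq0 -/(Q u) sQ.
    by rewrite sqr_sqrtr ?ltW// -mulrA mulVf ?mulr1// gt_eqF.
  move=> C0; case: Mq => _ /(_ C0) q0; case: Mq' => _ /(_ C0) q'0.
  rewrite !mxE mulr_gt0 ?invr_gt0 ?sqrtr_gt0//.
  have [->|u1] := eqVneq u 1; first
    by rewrite expr1n mul1r ltr_wpDl// mulr_ge0 ?sqr_ge0// ltW.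
  rewrite ltr_pwDl//; first by rewrite mulr_gt0// exprn_even_gt0//= subr_eq0 eq_sym.
  by rewrite mulr_ge0 ?sqr_ge0// ltW.
- by move=> n nq nq' u; rewrite !metric_lin nq nq' !mulr0 addr0 mulr0.
Qed.

(* [M] meets [n^perp] in a connected totally geodesic surface. *)
Lemma concircular_metric_cst V q q' n : concircular nu C V ->
  M q -> M q' -> q + q' != 0 -> <[n, q]> = 0 -> <[n, q']> = 0 ->
  <[n, V q]> = <[n, V q']>.
Proof.
move=> [_ _ [mu _ covV]] Mq Mq' qq' nq nq'.
have [c [c0 c1 dc Mc cn]] := space_form_path Mq Mq' qq'.
(* The path [c] stays in n^perp, so its velocity is orthogonal to n; this makes the derivative of
   <n, V> along [c] vanish. *)
rewrite -{1}c0 -{1}c1; apply: (@is_derive_0_is_cst R (fun u => <[n, V (c u)]>)) => u.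
have hc : is_derive u 1 c ('D_1 c u) by exact: derivableP.
set X := 'D_1 c u in hc.
have cX : <[c u, X]> = 0.
  have hQ := is_derive_metric nu hc hc.
  have : is_derive u 1 (fun y => <[c y, c y]>) 0.
    have -> : (fun y => <[c y, c y]>) = cst C^-1.
      by apply/funext => y; case: (Mc y).
    exact: is_derive_cst.
  by move=> /(is_derive_unique hQ); rewrite [metric _ X _]metricC; lra.
have nX : <[n, X]> = 0.
  have hn := is_derive_metric_cst nu n hc.
  have : is_derive u 1 (fun y => <[n, c y]>) 0.
    have -> : (fun y => <[n, c y]>) = cst 0.
      by apply/funext => y; rewrite cn.
    exact: is_derive_cst.
  exact: is_derive_unique hn.
have [g [U [openU Uc smg gV]]] := covV (c u) X (Mc u) cX.
rewrite /tangent_proj => hcov.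
have dg : differentiable g (c u) := smg [::] _ Uc.
have hgc := is_derive_diff dg hc.
have := is_derive_metric_cst nu n hgc.
rewrite /=.
(* The flat derivative is mu X plus a multiple of the position, and both are orthogonal to n. *)
have -> : 'D_X g (c u) = mu (c u) *: X + (C * <['D_X g (c u), c u]>) *: c u.
  by rewrite hcov subrK.
rewrite metricDr !metricZr nX (cn n nq nq') !mulr0 addr0.
(* [g] is known to agree with V only on the part of M inside [U], where [c] remains near [u]. *)
apply: near_eq_is_derive.
have cU : \forall y \near u, U (c y).
  have cc : {for u, continuous c}.
    by apply/differentiable_continuous/derivable1_diffP.
  by apply: cc; exact: open_nbhs_nbhs.
by near=> y; rewrite /= gV//; near: y.
Unshelve. all: by end_near. Qed.

(** The triple 3, 4, 5 gives explicit points of M off the first coordinate axis, which serve as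
    reference points beside (r, 0, 0, 0). *)
Lemma pythagorean_pair : exists x0 x1 : R, [/\ 0 < x0, 0 < x1
  & (-1) ^+ nu * (x0 * x0) + x1 * x1 = (-1) ^+ nu * r ^+ 2].
Proof.
case: (nu).
  exists (5 / 4 * r), (3 / 4 * r).
  split; [by rewrite mulr_gt0|by rewrite mulr_gt0|by rewrite expr1; field].
exists (3 / 5 * r), (4 / 5 * r).
split; [by rewrite mulr_gt0|by rewrite mulr_gt0|by rewrite expr0; field].
Qed.

(** Let w(q) = V(q) - V(p0). Normals orthogonal to q and p0 force w(q) into span(q, e0). The
    coefficient of e0 can be taken the same for all q; added to V(p0), it yields v. Tangency of V
    then fixes the remaining multiple of q. *)
Lemma concircular_constant V : concircular nu C V ->
  exists v, forall q, M q -> V q = v - (C * <[v, q]>) *: q.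
Proof.
move=> cV.
have Vtan q : M q -> <[q, V q]> = 0 by case: cV => _ + _; exact.
have [x0 [x1 [x0_gt0 x1_gt0 x01]]] := pythagorean_pair.
have x1N0 : x1 != 0 by rewrite gt_eqF.
pose p0 := vec4 r 0 0 0; pose pa := vec4 x0 x1 0 0; pose pb := vec4 x0 0 x1 0.
have Mp0 : M p0.
  rewrite /space_form/= curvatureV metricE !vec4E; split=> //; ring.
have Mpa : M pa.
  rewrite /space_form/= curvatureV metricE !vec4E -x01; split=> //; ring.
have Mpb : M pb.
  rewrite /space_form/= curvatureV metricE !vec4E -x01; split=> //; ring.
have add_neq0 q q' i : q 0 i + q' 0 i != 0 -> q + q' != 0.
  by apply: contra => /eqP /matrixP /(_ 0 i); rewrite !mxE => ->.
have cst_off q q' i n : M q -> M q' -> q 0 i + q' 0 i != 0 ->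
    <[n, q]> = 0 -> <[n, q']> = 0 -> <[n, V q]> = <[n, V q']>.
  move=> Mq Mq' qi nq nq'.
  by apply: concircular_metric_cst => //; exact: (add_neq0 _ _ i).
pose w q := V q - V p0; pose e0 : 'rV[R]_4 := vec4 1 0 0 0.
(* Here q is p0 or its antipode, and for the antipode no path to p0 is available; the comparison
   passes through [pa] or [pb] instead. *)
have axis q : M q -> q 0 1 = 0 -> q 0 2 = 0 -> q 0 3 = 0 ->
    [/\ w q 0 1 = 0, w q 0 2 = 0 & w q 0 3 = 0].
  move=> Mq q1 q2 q3.
  have via n q' i : M q' -> q' 0 i != 0 -> i != 0 -> n 0 0 = 0 ->
      <[n, q']> = 0 -> <[n, w q]> = 0.
    move=> Mq' q'i i0 n0 nq'; rewrite metricC metricBl ![metric _ _ n]metricC.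
    have z p : p 0 1 = 0 -> p 0 2 = 0 -> p 0 3 = 0 -> p 0 i = 0.
      by move=> ? ? ?; move: i i0 {q'i}; apply: ord4_ind => //; rewrite eqxx.
    rewrite (cst_off q q' i n)// ?(cst_off p0 q' i n)// ?subrr//.
    - by rewrite z ?vec4E// add0r.
    - by rewrite metricE n0 !vec4E; ring.
    - by rewrite z// add0r.
    - by rewrite metricE n0 q1 q2 q3; ring.
  split.
  - have := via (vec4 0 1 0 0) pb 2; rewrite !metricE !vec4E.
    rewrite !(mul0r, mulr0, mul1r, mulr1, add0r, addr0).
    by apply.
  - have := via (vec4 0 0 1 0) pa 1; rewrite !metricE !vec4E.
    rewrite !(mul0r, mulr0, mul1r, mulr1, add0r, addr0).
    by apply.
  - have := via (vec4 0 0 0 1) pa 1; rewrite !metricE !vec4E.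
    rewrite !(mul0r, mulr0, mul1r, mulr1, add0r, addr0).
    by apply.
(* Off the axis, the normals (0, q2, -q1, 0), (0, q3, 0, -q1) and (0, 0, q3, -q2) are orthogonal to
   both q and p0. Pairing them with w(q) gives the 2 x 2 minors of the spatial parts of w(q) and
   q. *)
have minors q : M q -> [/\ w q 0 1 * q 0 2 = w q 0 2 * q 0 1,
    w q 0 1 * q 0 3 = w q 0 3 * q 0 1 & w q 0 2 * q 0 3 = w q 0 3 * q 0 2].
  move=> Mq.
  have [[i i0 qi]|q_axis] := pselect (exists2 i : 'I_4, i != 0 & q 0 i != 0).
    have minor n : n 0 0 = 0 -> <[n, q]> = 0 -> <[n, w q]> = 0.
      move=> n0 nq; rewrite metricC metricBl ![metric _ _ n]metricC.
      rewrite (cst_off q p0 i n) ?subrr//.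
      - by move: i i0 qi; apply: ord4_ind; rewrite ?eqxx ?vec4E ?addr0.
      - by rewrite metricE n0 !vec4E; ring.
    have := minor (vec4 0 (q 0 2) (- q 0 1) 0).
    have := minor (vec4 0 (q 0 3) 0 (- q 0 1)).
    have := minor (vec4 0 0 (q 0 3) (- q 0 2)).
    rewrite !metricE !vec4E => h23 h13 h12.
    have {}h23 := h23 erefl ltac:(ring).
    have {}h13 := h13 erefl ltac:(ring).
    have {}h12 := h12 erefl ltac:(ring).
    by split; lra.
  have z i : i != 0 -> q 0 i = 0.
    by move=> i0; apply/eqP/negP => /negP qi; apply: q_axis; exists i.
  by rewrite !z// !mulr0.
(* By the minors, the spatial part of w(q) is a multiple f of that of q, and e0 absorbs the first
   coordinate. When q has no spatial part, [axis] allows f = 0. *)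
have dec q : M q -> exists f h, w q = f *: q + h *: e0.
  move=> Mq; have [m12 m13 m23] := minors q Mq.
  have dec_of f : w q 0 1 = f * q 0 1 -> w q 0 2 = f * q 0 2 ->
      w q 0 3 = f * q 0 3 -> exists f h, w q = f *: q + h *: e0.
    move=> w1 w2 w3; exists f, (w q 0 0 - f * q 0 0).
    apply/rowP; apply: ord4_ind; rewrite ?w1 ?w2 ?w3;
      rewrite [RHS]mxE [X in _ = X + _]mxE [X in _ = _ + X]mxE vec4E; ring.
  have [q1|q1] := eqVneq (q 0 1) 0; last first.
    apply: (dec_of (w q 0 1 / q 0 1)); first by rewrite divfK.
    - by apply: (mulIf q1); rewrite -m12 mulrAC divfK.
    - by apply: (mulIf q1); rewrite -m13 mulrAC divfK.
  have [q2|q2] := eqVneq (q 0 2) 0; last first.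
    apply: (dec_of (w q 0 2 / q 0 2)); last 2 first.
    - by rewrite divfK.
    - by apply: (mulIf q2); rewrite -m23 mulrAC divfK.
    - by apply: (mulIf q2); rewrite m12 mulrAC divfK.
  have [q3|q3] := eqVneq (q 0 3) 0; last first.
    apply: (dec_of (w q 0 3 / q 0 3)); last by rewrite divfK.
    - by apply: (mulIf q3); rewrite m13 mulrAC divfK.
    - by apply: (mulIf q3); rewrite m23 mulrAC divfK.
  by have [w1 w2 w3] := axis q Mq q1 q2 q3; apply: (dec_of 0); rewrite mul0r.
(* A normal n with first coordinate 1 that kills q and q' reads off the coefficients of e0, up to
   the common sign of <n, e0>. *)
have off q q' i n : M q -> M q' -> q 0 i + q' 0 i != 0 -> n 0 0 = 1 ->
    <[n, q]> = 0 -> <[n, q']> = 0 ->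
    forall f h f' h', w q = f *: q + h *: e0 -> w q' = f' *: q' + h' *: e0 ->
    h = h'.
  move=> Mq Mq' qi n0 nq nq' f h f' h' wq wq'.
  have : <[n, w q]> = <[n, w q']>.
    by rewrite ![metric _ n _]metricC !metricBl ![metric _ _ n]metricC
      (cst_off q q' i n).
  rewrite wq wq' !metricDr !metricZr nq nq' !mulr0 !add0r metricE !vec4E n0.
  by case: (nu); rewrite ?expr1 ?expr0; lra.
have [fa [h wa]] := dec pa Mpa.
have [fb [hb wb]] := dec pb Mpb.
(* Chosen so that (1, y, 0, 0) is orthogonal to [pa] and (1, 0, y, 0) to [pb]; adding both entries
   gives a normal for the two points at once. *)
pose y := - (-1) ^+ nu * x0 / x1.
have hb_eq : hb = h.
  apply: (off pb pa 2 (vec4 1 y y 0)) wb wa => //; rewrite ?metricE ?vec4E ?addr0//.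
  - by rewrite /y; field.
  - by rewrite /y; field.
exists (V p0 + h *: e0) => q Mq.
have [f [h' wq]] := dec q Mq.
have {f h' wq} [f wq] : exists f, w q = f *: q + h *: e0.
  (* On the axis the splitting along q and e0 is not unique, and the difference (h' - h) e0 can be
     moved into the multiple of q. *)
  suff H : (h' = h) \/ q = q 0 0 *: e0.
    case: H => [<-|qe]; first by exists f.
    exists (f + (h' - h) / q 0 0); rewrite wq scalerDl -addrA; congr (_ + _).
    rewrite {2}qe scalerA divfK -?scalerDl ?subrK//.
    apply/eqP => q00; case: (Mq); rewrite {1 2}qe q00 scale0r metric0l => /esym/eqP.
    by rewrite invr_eq0 (negPf curvature_neq0).
  (* A nonzero coordinate q2 or q3 leaves an entry of n free to solve <n, q> = 0 while n stays
     orthogonal to [pa]. If only q1 is nonzero, that entry is the second one, and [pb], whose second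
     coordinate is 0, replaces [pa]. *)
  have [q2|q2] := eqVneq (q 0 2) 0; last first.
    left; apply: (off q pa 2 (vec4 1 y
      (- ((-1) ^+ nu * q 0 0 + y * q 0 1) / q 0 2) 0)) wq wa => //;
      rewrite ?metricE ?vec4E ?addr0//.
    - by field.
    - by rewrite /y; field; rewrite q2.
  have [q3|q3] := eqVneq (q 0 3) 0; last first.
    left; apply: (off q pa 3 (vec4 1 y 0
      (- ((-1) ^+ nu * q 0 0 + y * q 0 1) / q 0 3))) wq wa => //;
      rewrite ?metricE ?vec4E ?addr0//.
    - by field.
    - by rewrite /y; field; rewrite q3.
  have [q1|q1] := eqVneq (q 0 1) 0; last first.
    left; rewrite -hb_eq; apply: (off q pb 1 (vec4 1
      (- ((-1) ^+ nu * q 0 0) / q 0 1) y 0)) wq wb => //;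
      rewrite ?metricE ?vec4E ?addr0//.
    - by rewrite q2 q3; field.
    - by rewrite /y; field; rewrite x1N0.
  right; apply/rowP; apply: ord4_ind; rewrite [RHS]mxE vec4E ?q1 ?q2 ?q3; ring.
have Vq : V q = V p0 + h *: e0 + f *: q.
  by rewrite -addrA [h *: e0 + _]addrC -wq /w addrC subrK.
have f_eq : f = - (C * <[V p0 + h *: e0, q]>).
  have := Vtan q Mq; rewrite Vq metricC metricDl metricZl => e.
  have nq := space_form_normE Mq.
  have : C * (<[V p0 + h *: e0, q]> + f * <[q, q]>) = 0 by rewrite e mulr0.
  rewrite mulrDr mulrCA nq mulr1 => /eqP; rewrite addr_eq0 => /eqP ->.
  by rewrite opprK.
by rewrite Vq {1}f_eq scaleNr.
Qed.

End SpaceForm.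

(** * Constant vectors give concircular fields *)

Section QuadraticField.
Context {R : realType} (nu : bool) (v : 'rV[R]_4).
Implicit Types (a X Y p : 'rV[R]_4) (b k : R).

(* A class of fields stable under directional derivation and containing
   [p |-> v - C <v, p> p]. *)
Definition quadratic_field a b X k p : 'rV[R]_4 :=
  a + b *: p + metric nu v p *: X + (k * metric nu v p) *: p.

Lemma is_derive_metricr p Y :
  is_derive p Y (fun q => metric nu v q) (metric nu v Y).
Proof. exact: is_derive_metric_cst (is_derive_id p Y). Qed.

Lemma is_derive_quadratic_field a b X k p Y :
  is_derive p Y (quadratic_field a b X k)
    (quadratic_field (b *: Y + metric nu v Y *: X) (k * metric nu v Y)
      (k *: Y) 0 p).
Proof.
have h1 := is_derive_scalemx (is_derive_cst b p Y) (is_derive_id p Y).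
have h2 := is_derive_scalemx (is_derive_metricr p Y) (is_derive_cst X p Y).
have hk : is_derive p Y (fun q => k * metric nu v q) (k * metric nu v Y).
  exact: is_deriveZ (is_derive_metricr p Y).
have h3 := is_derive_scalemx hk (is_derive_id p Y).
have h := is_deriveD (is_deriveD (is_deriveD (is_derive_cst a p Y) h1) h2) h3.
apply: (is_derive_eq h).
apply/rowP => i; rewrite /quadratic_field !mxE.
rewrite /cst/=; ring.
Qed.

Lemma differentiable_metricr p : differentiable (fun q => metric nu v q) p.
Proof.
by apply: differentiable_metric => i; exact: differentiable_coord.
Qed.

Lemma differentiable_quadratic_field a b X k p :
  differentiable (quadratic_field a b X k) p.
Proof.
have dm := differentiable_metricr p.
apply: differentiable_row => i.
have -> : (fun q => quadratic_field a b X k q 0 i) =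
    cst (a 0 i) + b *: (fun q : 'rV[R]_4 => q 0 i) +
    (X 0 i) *: (fun q => metric nu v q) +
    k *: ((fun q => metric nu v q) * (fun q : 'rV[R]_4 => q 0 i)).
  apply/funext => q; rewrite -[RHS]/(a 0 i + b * q 0 i +
    X 0 i * metric nu v q + k * (metric nu v q * q 0 i)).
  by rewrite /quadratic_field !mxE; ring.
have dc := differentiable_coord p 0 i.
apply: differentiableD; last exact/differentiableZ/differentiableM.
apply: differentiableD; last exact: differentiableZ.
apply: differentiableD; last exact: differentiableZ.
exact: differentiable_cst.
Qed.

Lemma smooth_quadratic_field a b X k (U : set 'rV[R]_4) :
  smooth_on U (quadratic_field a b X k).
Proof.
move=> vs p _.
suff [a' [b' [X' [k' ->]]]] : exists a' b' X' k',
    iterated_derive (quadratic_field a b X k) vs = quadratic_field a' b' X' k'.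
  exact: differentiable_quadratic_field.
elim: vs => [|Y vs [a' [b' [X' [k' IH]]]]]; first by exists a, b, X, k.
rewrite /= -/(iterated_derive _ _) IH.
exists (b' *: Y + metric nu v Y *: X'), (k' * metric nu v Y), (k' *: Y), 0.
by apply/funext => q; have [_ ->] := is_derive_quadratic_field a' b' X' k' q Y.
Qed.

Lemma smooth_metricr k (U : set 'rV[R]_4) :
  smooth_on U (fun p => k * metric nu v p).
Proof.
(* [foldr] differentiates in the last direction first, so the list is split at its end; after one
   derivative the function is constant. *)
move=> vs p _; case/lastP: vs => [|vs Y].
  by apply: differentiableZ; exact: differentiable_metricr.
rewrite /iterated_derive foldr_rcons.
have -> : 'D_Y (fun p => k * metric nu v p) = cst (k * metric nu v Y).
  by apply/funext => q; have [_ ->] := is_deriveZ k (is_derive_metricr q Y).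
suff [c ->] : exists c, foldr (fun v g => 'D_v g) (cst (k * metric nu v Y)) vs
    = cst c by exact: differentiable_cst.
elim: vs => [|Z vs [c IH]]; first by exists (k * metric nu v Y).
by exists 0; rewrite /= IH; apply/funext => q; rewrite derive_cst.
Qed.

End QuadraticField.

Section ConstantConcircular.
Context {R : realType} (nu : bool) (C : R).

Lemma local_extension_id {E F : normedModType R} (S : set E) (f : E -> F) p :
  smooth_on setT f -> local_extension S f p f.
Proof. by move=> sf; exists setT; split=> //; exact: openT. Qed.

(** The flat derivative in a tangent direction X is - C<v, p> X - C<v, X> p. Its second term is
    normal to M, which leaves the concircular factor - C<v, p>. *)
Lemma constant_concircular (v : 'rV[R]_4) : C != 0 ->
  concircular nu C (fun p => v - (C * metric nu v p) *: p).
Proof.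
move=> C0; set V := (fun p => _).
have VE : V = quadratic_field nu v v 0 0 (- C).
  apply/funext => p.
  by rewrite /V /quadratic_field scale0r scaler0 !addr0 mulNr scaleNr.
have sV : smooth_on setT V by rewrite VE; exact: smooth_quadratic_field.
split.
- by move=> p _; exists V; exact: local_extension_id.
- move=> p [pp _]; rewrite /tangent_at metricC metricBl metricZl pp.
  by rewrite mulrAC divff// mul1r subrr.
- exists (fun p => - C * metric nu v p).
    move=> p _; exists (fun p => - C * metric nu v p).
    by apply: local_extension_id; exact: smooth_metricr.
  move=> p X [pp _] pX; exists V; first exact: local_extension_id.
  have [_ DV] := is_derive_quadratic_field nu v v 0 0 (- C) p X.
  rewrite /tangent_at in pX.
  rewrite VE DV /tangent_proj /quadratic_field.
  rewrite !metricDl !metricZl !metric0l [metric _ X p]metricC pX pp.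
  by apply/rowP => i; rewrite !mxE; field.
Qed.

End ConstantConcircular.

(** * The Frenet equations in the flat ambient space *)

Section FrenetEquations.
Context {R : realType} (nu : bool) (C : R) (I : set R).
Context (gamma : R -> 'rV[R]_4) (kappa tau : R -> R) (T N B : R -> 'rV[R]_4).
Context (openI : open I).
Context (hgamma : smooth_curve nu C I gamma).
Context (hfrenet : frenet_apparatus nu C I gamma kappa tau T N B).
Implicit Types (s : R) (W : R -> 'rV[R]_4).

Lemma near_interval s : I s -> \forall u \near s, I u.
Proof. by move=> Is; exact: open_nbhs_nbhs. Qed.

Lemma is_derive_gamma s : I s -> is_derive s 1 gamma (T s).
Proof.
move=> Is; rewrite (frenet_T hfrenet Is) derive1E; apply: derivableP.
by have [sg _] := hgamma; exact: (sg 0).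
Qed.

Lemma T_near s : I s -> \forall u \near s, derive1 gamma u = T u.
Proof.
move=> Is; near=> u; rewrite (frenet_T hfrenet)//.
by near: u; exact: near_interval.
Unshelve. all: by end_near. Qed.

(** Differentiating <gamma, W> = 0 gives <W', gamma> = - <W, T>, which determines the normal
    component that the covariant derivative discards. *)
Lemma is_derive_covariant W s Y : I s -> derivable W s 1 ->
  (forall u, I u -> tangent_at nu (gamma u) (W u)) ->
  covariant_along nu C gamma W s = Y ->
  is_derive s 1 W (Y - (C * metric nu (W s) (T s)) *: gamma s).
Proof.
move=> Is dW tW <-.
have hW := derivableP dW.
have gW : metric nu ('D_1 W s) (gamma s) = - metric nu (W s) (T s).
  have h := is_derive_metric nu (is_derive_gamma Is) hW.
  have h0 : is_derive s 1 (fun u => metric nu (gamma u) (W u)) 0.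
    apply: (near_eq_is_derive _ (is_derive_cst 0 s 1)).
    near=> u; rewrite /cst tW//.
    by near: u; exact: near_interval.
  have := is_derive_unique h h0.
  by rewrite [metric _ (gamma s) _]metricC [metric _ (T s) _]metricC; lra.
apply: (is_derive_eq hW).
rewrite /covariant_along /tangent_proj derive1E gW.
by rewrite mulrN scaleNr opprK addrK.
Unshelve. all: by end_near. Qed.

Lemma is_derive_T s : I s -> is_derive s 1 T (kappa s *: N s - C *: gamma s).
Proof.
move=> Is.
have dT : derivable T s 1.
  apply: (near_eq_derivable (T_near Is)).
  by have [sg _] := hgamma; exact: (sg 1).
have [TT _ _] := frenet_unit hfrenet Is.
apply: is_derive_eq.
  apply: (is_derive_covariant Is dT) (frenet_eqT hfrenet Is) => u Iu.
  by have [] := frenet_tangent hfrenet Iu.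
by rewrite TT mulr1.
Qed.

Lemma is_derive_N s : I s ->
  is_derive s 1 N (- kappa s *: T s + tau s *: B s).
Proof.
move=> Is.
have dN : derivable N s 1 by exact: (@frenet_smoothN _ _ _ _ _ _ _ _ _ _ hfrenet 0%N).
have [TN _ _] := frenet_orthogonal hfrenet Is.
apply: is_derive_eq.
  apply: (is_derive_covariant Is dN) (frenet_eqN hfrenet Is) => u Iu.
  by have [] := frenet_tangent hfrenet Iu.
by rewrite metricC TN mulr0 scale0r subr0.
Qed.

Lemma is_derive_B s : I s -> is_derive s 1 B (- tau s *: N s).
Proof.
move=> Is.
have dB : derivable B s 1 by exact: (@frenet_smoothB _ _ _ _ _ _ _ _ _ _ hfrenet 0%N).
have [_ TB _] := frenet_orthogonal hfrenet Is.
apply: is_derive_eq.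
  apply: (is_derive_covariant Is dB) (frenet_eqB hfrenet Is) => u Iu.
  by have [] := frenet_tangent hfrenet Iu.
by rewrite metricC TB mulr0 scale0r subr0.
Qed.

Lemma metric_frame s t l z : I s ->
  [/\ metric nu (t *: T s + l *: N s + z *: B s) (T s) = t,
      metric nu (t *: T s + l *: N s + z *: B s) (N s) = l,
      metric nu (t *: T s + l *: N s + z *: B s) (B s) = z
    & metric nu (t *: T s + l *: N s + z *: B s) (gamma s) = 0].
Proof.
move=> Is; have [TT NN BB] := frenet_unit hfrenet Is.
have [TN TB NB] := frenet_orthogonal hfrenet Is.
have [] := frenet_tangent hfrenet Is; rewrite /tangent_at => gT gN gB.
rewrite !metricDl !metricZl ![metric nu _ (gamma s)]metricC gT gN gB.
rewrite [metric _ (N s) (T s)]metricC [metric _ (B s) (T s)]metricC.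
rewrite [metric _ (B s) (N s)]metricC TT NN BB TN TB NB.
by split; ring.
Qed.

(* [kappa] and [tau] are arbitrary functions, but on [I] the Frenet equations
   express them through derivatives of [gamma], [N] and [B]. *)
Lemma torsion_ratio_continuous : exists f : R -> R,
  forall s, I s -> {for s, continuous f} /\ f s = tau s / kappa s.
Proof.
exists (fun u => metric nu (derive1n 1 N u) (B u) /
  metric nu (derive1n 2 gamma u) (N u)) => s Is.
have k0 := frenet_kappa_gt0 hfrenet Is.
have tauE : metric nu (derive1n 1 N s) (B s) = tau s.
  have [_ _ BB] := frenet_unit hfrenet Is.
  have [_ TB _] := frenet_orthogonal hfrenet Is.
  rewrite derive1n1 derive1E; have [_ ->] := is_derive_N Is.
  by rewrite metricDl !metricZl TB BB; ring.
have kappaE : metric nu (derive1n 2 gamma s) (N s) = kappa s.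
  have [_ NN _] := frenet_unit hfrenet Is.
  have [_ gN _] := frenet_tangent hfrenet Is.
  have -> : derive1n 2 gamma s = kappa s *: N s - C *: gamma s.
    rewrite derive1nS derive1n1.
    apply: near_derive1 (is_derive_T Is).
    by near do apply/esym; exact: T_near.
  by rewrite metricBl !metricZl NN gN; ring.
split; last by rewrite tauE kappaE.
have sN : smooth_on_interval I N := @frenet_smoothN _ _ _ _ _ _ _ _ _ _ hfrenet.
have dN := derivableP (sN 1%N s Is); have dN0 := derivableP (sN 0%N s Is).
have dB := is_derive_B Is.
have [sg _] := hgamma; have dg := derivableP (sg 2 s Is).
have [d1 _] := is_derive_metric nu dN dB.
have [d2 _] := is_derive_metric nu dg dN0.
have c1 := differentiable_continuous ((derivable1_diffP _ _).1 d1).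
have c2 := differentiable_continuous ((derivable1_diffP _ _).1 d2).
by apply: continuousM => //; apply: continuousV => //; rewrite /= kappaE gt_eqF.
Unshelve. all: by end_near. Qed.

End FrenetEquations.

(** Taking both values c and 0 would force the value c / 2 in between, by the intermediate value
    theorem. *)
Lemma continuous_two_valued {R : realType} (I : set R) (f : R -> R) (c : R) :
  is_interval I -> (forall s, I s -> {for s, continuous f}) ->
  (forall s, I s -> f s = c \/ f s = 0) ->
  forall s0, I s0 -> f s0 != 0 -> forall s, I s -> f s = c.
Proof.
move=> itvI cf f2 s0 Is0 fs0 s Is.
have fs0c : f s0 = c by case: (f2 s0 Is0) fs0 => // ->; rewrite eqxx.
have c0 : c != 0 by rewrite -fs0c.
case: (f2 s Is) => // fs.
have key a b : I a -> I b -> a <= b ->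
    Num.min (f a) (f b) <= c / 2 <= Num.max (f a) (f b) -> False.
  move=> Ia Ib ab /(IVT ab)[].
    apply: continuous_in_subspaceT => x; rewrite inE/= in_itv/= => /andP[ax xb].
    by apply: cf; apply: (itvI a b) => //; rewrite ax.
  move=> x; rewrite in_itv/= => /andP[ax xb] fx.
  have Ix : I x by apply: (itvI a b) => //; rewrite ax.
  by case: (f2 x Ix) => fx'; move: c0; rewrite (_ : c = 0) ?eqxx//; lra.
have mm : Num.min c 0 <= c / 2 <= Num.max c 0.
  by rewrite ge_min le_max; case: (leP c 0) => h; apply/andP; split; apply/orP;
    [left|right|right|left]; lra.
exfalso; case: (leP s s0) => [h|/ltW h].
- by apply: (key _ _ Is Is0 h); rewrite fs fs0c minC maxC.
- by apply: (key _ _ Is0 Is h); rewrite fs fs0c.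
Qed.

(** * The two implications of the characterization *)

Section Main.
Context {R : realType} (nu : bool) (C r : R).
Context (hr : 0 < r).
Context (hC : C = (-1) ^+ nu / r ^+ 2).
Context (I : set R) (gamma : R -> 'rV[R]_4) (kappa tau : R -> R).
Context (T N B : R -> 'rV[R]_4).
Context (openI : open I).
Context (intervalI : is_interval I).
Context (hgamma : smooth_curve nu C I gamma).
Context (hfrenet : frenet_apparatus nu C I gamma kappa tau T N B).
Context (nonplanar : ~ planar I tau).

(* A zero of [z] is no obstacle: near an interior zero [tau] vanishes, so that
   [tau / kappa] takes only the values [c] and [0]. *)
Lemma curvature_of_helix V lambda :
  proper_concircular_helix nu C I gamma tau N V lambda ->
  constant_rectifying_slope I gamma T N B V lambda ->
  exists (m rho : R) (mu : R -> R),
     [/\ m != 0,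
         rho != 0,
         forall s, I s -> kappa s = m * mu s,
         forall s, I s -> tau s = rho * kappa s
       & forall s, I s ->
           [/\ derivable mu s 1, derivable (derive1 mu) s 1
             & derive1n 2 mu s + C * (rho ^+ 2 / (1 + rho ^+ 2)) * mu s = 0]].
Proof.
move=> [[cV hlam] _ lam0] [t [z [hV [c hc]]]].
have C0 := curvature_neq0 hr hC.
have [v vV] := concircular_constant hr hC cV.
have Mg s : I s -> space_form nu C (gamma s) by case: hgamma => _; exact.
(* The constant vector v in the moving frame: its tangential part is V, and its component along
   gamma is C<v, gamma>. *)
have vE s : I s ->
    v = t s *: T s + lambda *: N s + z s *: B s + (C * metric nu v (gamma s)) *: gamma s.
  by move=> Is; rewrite -hV// vV ?subrK//; exact: Mg.
have vW s W : I s -> tangent_at nu (gamma s) W ->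
    metric nu v W = metric nu (t s *: T s + lambda *: N s + z s *: B s) W.
  by move=> Is gW; rewrite {1}(vE s Is) metricDl metricZl gW mulr0 addr0.
have tE s : I s -> t s = metric nu v (T s).
  move=> Is; have [gT _ _] := frenet_tangent hfrenet Is.
  by rewrite (vW s)//; have [-> _ _ _] := metric_frame hfrenet (t s) lambda (z s) Is.
have lE s : I s -> metric nu v (N s) = lambda.
  move=> Is; have [_ gN _] := frenet_tangent hfrenet Is.
  by rewrite (vW s)//; have [_ -> _ _] := metric_frame hfrenet (t s) lambda (z s) Is.
have zE s : I s -> z s = metric nu v (B s).
  move=> Is; have [_ _ gB] := frenet_tangent hfrenet Is.
  by rewrite (vW s)//; have [_ _ -> _] := metric_frame hfrenet (t s) lambda (z s) Is.
pose a s := metric nu v (gamma s).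
have da s : I s -> is_derive s 1 a (t s).
  move=> Is; rewrite tE//; apply: is_derive_metric_cst.
  exact: (is_derive_gamma hgamma hfrenet Is).
have dt s : I s -> is_derive s 1 (fun u => metric nu v (T u))
    (kappa s * lambda - C * a s).
  move=> Is; have h := is_derive_metric_cst nu v (is_derive_T openI hgamma hfrenet Is).
  apply: (is_derive_eq h).
  by rewrite metricC metricBl !metricZl ![metric _ _ v]metricC lE.
have dz s : I s -> is_derive s 1 (fun u => metric nu v (B u)) (- tau s * lambda).
  move=> Is; have h := is_derive_metric_cst nu v (is_derive_B openI hgamma hfrenet Is).
  by apply: (is_derive_eq h); rewrite metricZr lE.
have tz s : I s -> kappa s * t s = tau s * z s.
  move=> Is; have h := is_derive_metric_cst nu v (is_derive_N openI hgamma hfrenet Is).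
  have h0 : is_derive s 1 (fun u => metric nu v (N u)) 0.
    apply: (near_eq_is_derive _ (is_derive_cst lambda s 1)).
    near=> u; rewrite /cst lE//.
    by near: u; exact: near_interval.
  have := is_derive_unique h h0.
  by rewrite metricDr !metricZr -tE// -zE//; lra.
have [f hf] := torsion_ratio_continuous openI hgamma hfrenet.
have kN0 s : I s -> kappa s != 0.
  by move=> Is; rewrite gt_eqF// (frenet_kappa_gt0 hfrenet).
have f2 s : I s -> f s = c \/ f s = 0.
  move=> Is; have [cf fs] := hf s Is.
  have [|fc] := eqVneq (f s) c; [by left|right].
  (* By continuity [f] avoids c near s. There z must vanish, since z != 0 would give c = t / z = tau
     / kappa. Hence z' = - tau lambda is zero at s, and so is tau. *)
  have fN : \forall u \near s, f u != c.
    have : nbhs (f s) [set x | x != c].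
      by apply: open_nbhs_nbhs; split=> //; exact: open_neq.
    by move=> /cf.
  have dz0 : is_derive s 1 (fun u => metric nu v (B u)) 0.
    apply: (near_eq_is_derive _ (is_derive_cst 0 s 1)).
    near=> u; have Iu : I u by near: u; exact: near_interval.
    have fu : f u != c by near: u.
    rewrite /cst -zE//; apply/esym/eqP; apply: contraT => zu.
    case/eqP: fu; have [_ ->] := hf u Iu; rewrite -(hc u Iu zu).
    by apply/eqP; rewrite eqr_div ?kN0// -tz// mulrC.
  have := is_derive_unique (dz s Is) dz0 => /eqP.
  by rewrite mulf_eq0 oppr_eq0 (negPf lam0) orbF fs => /eqP ->; rewrite mul0r.
(* Nonplanarity supplies a point where tau / kappa is not 0, which singles out the value c on all of
   I. *)
have [s0 [Is0 tau0]] : exists s0, I s0 /\ tau s0 != 0.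
  apply: contrapT => /forallNP h; apply: nonplanar => s Is.
  by apply/eqP; apply: contrapT => /negP ts; apply: (h s).
have fc s : I s -> f s = c.
  apply: (continuous_two_valued intervalI _ f2 Is0).
    by move=> u /hf[].
  by have [_ ->] := hf s0 Is0; rewrite mulf_neq0// invr_neq0// kN0.
have tauE s : I s -> tau s = c * kappa s.
  by move=> Is; rewrite -(fc s Is); have [_ ->] := hf s Is; rewrite divfK// kN0.
have c0 : c != 0 by apply: contra tau0 => /eqP c0; rewrite tauE// c0 mul0r.
have c1 : 1 + c ^+ 2 != 0 by rewrite gt_eqF// ltr_pwDl ?sqr_ge0.
have tcz s : I s -> t s = c * z s.
  move=> Is; apply: (mulfI (kN0 s Is)); rewrite tz// tauE//; ring.
(* Two expressions for t' are compared: kappa lambda - C a, and c z' = - c^2 kappa lambda. *)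
have key s : I s -> kappa s * lambda * (1 + c ^+ 2) = C * a s.
  move=> Is.
  have h : is_derive s 1 (fun u => metric nu v (T u)) (c * (- tau s * lambda)).
    apply: (near_eq_is_derive _ (is_deriveZ c (dz s Is))).
    near=> u; have Iu : I u by near: u; exact: near_interval.
    by rewrite -tE// tcz// zE.
  have := is_derive_unique (dt s Is) h.
  rewrite tauE//; lra.
have da1 s : I s -> derive1 a s = metric nu v (T s).
  by move=> Is; rewrite derive1E; have [_ ->] := da s Is; exact: tE.
have da2 s : I s -> is_derive s 1 (derive1 a) (kappa s * lambda - C * a s).
  move=> Is; apply: (near_eq_is_derive _ (dt s Is)).
  near=> u; rewrite da1//.
  by near: u; exact: near_interval.
(* [key] solved for kappa: mu is the height <v, gamma> and rho is the rectifying slope. *)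
exists (C / (lambda * (1 + c ^+ 2))), c, a; split=> //.
- by rewrite mulf_neq0// invr_neq0// mulf_neq0.
- move=> s Is; apply: (mulIf c1); apply: (mulIf lam0).
  by rewrite mulrAC key//; field; rewrite c1.
- move=> s Is; have [d1 _] := da s Is; have [d2 e2] := da2 s Is; split=> //.
  rewrite derive1nS derive1n1 derive1E e2.
  have -> : kappa s * lambda = C * a s / (1 + c ^+ 2).
    by apply: (mulIf c1); rewrite divfK// key.
  by field.
Unshelve. all: by end_near. Qed.

Lemma helix_of_curvature (m rho : R) (mu : R -> R) : rho != 0 ->
  (forall s, I s -> kappa s = m * mu s) ->
  (forall s, I s -> tau s = rho * kappa s) ->
  (forall s, I s ->
    [/\ derivable mu s 1, derivable (derive1 mu) s 1
      & derive1n 2 mu s + C * (rho ^+ 2 / (1 + rho ^+ 2)) * mu s = 0]) ->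
  exists (V : 'rV[R]_4 -> 'rV[R]_4) (lambda : R),
    proper_concircular_helix nu C I gamma tau N V lambda /\
    constant_rectifying_slope I gamma T N B V lambda.
Proof.
move=> rho0 kE tauE hmu.
have C0 := curvature_neq0 hr hC.
have rho1 : 1 + rho ^+ 2 != 0 by rewrite gt_eqF// ltr_pwDl ?sqr_ge0.
(* Setting lambda = 1 in kappa lambda (1 + rho^2) = C a gives a = b mu; then t = a' and z = t /
   rho. *)
pose b := (1 + rho ^+ 2) * m / C.
pose t s := b * derive1 mu s.
pose z s := rho^-1 * t s.
pose w s := t s *: T s + 1 *: N s + z s *: B s + (C * b * mu s) *: gamma s.
have dw s : I s -> is_derive s 1 w 0.
  move=> Is; have [d1 d2 e] := hmu s Is.
  have hm : is_derive s 1 (fun u => C * b * mu u) (C * b * derive1 mu s).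
    by rewrite derive1E; exact: is_deriveZ (derivableP d1).
  (* The derivative of t = b mu', with mu'' replaced by means of the differential equation. *)
  pose dt := b * (- (C * (rho ^+ 2 / (1 + rho ^+ 2)) * mu s)).
  have ht : is_derive s 1 t dt.
    have h := is_deriveZ b (derivableP d2).
    apply: (is_derive_eq h); congr (_ * _); move: e.
    by rewrite derive1nS derive1n1 derive1E => /eqP; rewrite addr_eq0 => /eqP.
  have hz : is_derive s 1 z (rho^-1 * dt) by exact: is_deriveZ.
  have h1 := is_derive_scalemx ht (is_derive_T openI hgamma hfrenet Is).
  have h2 := is_deriveZ 1 (is_derive_N openI hgamma hfrenet Is).
  have h3 := is_derive_scalemx hz (is_derive_B openI hgamma hfrenet Is).
  have h4 := is_derive_scalemx hm (is_derive_gamma hgamma hfrenet Is).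
  have h := is_deriveD (is_deriveD (is_deriveD h1 h2) h3) h4.
  apply: (is_derive_eq h); apply/rowP => i; rewrite !mxE.
  rewrite tauE// kE// /dt /z /t /b.
  by field; rewrite C0 rho0.
have wcst s s' : I s -> I s' -> w s = w s'.
  move=> Is Is'; apply/rowP => i.
  apply: (is_derive0_interval (f := fun u => w u 0 i) intervalI) => // u Iu.
  by have /is_derive_mxP/(_ 0 i) := dw u Iu; rewrite mxE.
(* A curve over an empty interval would be planar. The value of [w] at s0 serves as the constant
   vector v. *)
have [s0 Is0] : exists s0, I s0.
  apply: contrapT => /forallNP h; apply: nonplanar => s Is.
  by have := h s Is.
have Mg s : I s -> C * metric nu (gamma s) (gamma s) = 1.
  by case: hgamma => _ Mg Is; exact: (space_form_normE hr hC (Mg s Is)).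
pose V p := w s0 - (C * metric nu (w s0) p) *: p.
have Vg s : I s -> V (gamma s) = t s *: T s + 1 *: N s + z s *: B s.
  move=> Is; rewrite /V (wcst s0 s)// /w metricDl metricZl.
  have [_ _ _ ->] := metric_frame hfrenet (t s) 1 (z s) Is.
  by rewrite add0r [C * (_ * metric _ _ _)]mulrCA Mg// mulr1 addrK.
exists V, 1; split.
  split=> //.
  split; first exact: constant_concircular.
  move=> s Is; rewrite Vg// metricC.
  by have [_ -> _ _] := metric_frame hfrenet (t s) 1 (z s) Is.
exists t, z; split=> //; exists rho => s Is.
by rewrite /z mulf_eq0 negb_or => /andP[_ t0]; field; rewrite rho0.
Qed.

End Main.

Theorem proposition9 (R : realType) (nu : bool) (C r : R)
    (hr : 0 < r) (hC : C = (-1) ^+ nu / r ^+ 2)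
    (I : set R) (openI : open I) (intervalI : is_interval I)
    (gamma : R -> 'rV[R]_4) (kappa tau : R -> R) (T N B : R -> 'rV[R]_4)
    (hgamma : smooth_curve nu C I gamma)
    (harc : arclength nu I gamma)
    (hfrenet : frenet_apparatus nu C I gamma kappa tau T N B)
    (nonplanar : ~ planar I tau) :
  (exists (V : 'rV[R]_4 -> 'rV[R]_4) (lambda : R),
     proper_concircular_helix nu C I gamma tau N V lambda /\
     constant_rectifying_slope I gamma T N B V lambda)
  <->
  (exists (m rho : R) (mu : R -> R),
     [/\ m != 0,
         rho != 0,
         forall s, I s -> kappa s = m * mu s,
         forall s, I s -> tau s = rho * kappa s
       & forall s, I s ->
           [/\ derivable mu s 1, derivable (derive1 mu) s 1
             & derive1n 2 mu s + C * (rho ^+ 2 / (1 + rho ^+ 2)) * mu s = 0]]).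
Proof.
split=> [[V [lambda [hV hslope]]]|[m [rho [mu [_ rho0 kE tauE hmu]]]]].
- exact: (curvature_of_helix hr hC openI intervalI hgamma hfrenet nonplanar
    hV hslope).
- exact: (helix_of_curvature hr hC openI intervalI hgamma hfrenet nonplanar
    rho0 kE tauE hmu).
Qed.
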